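(* Let $k\ge0$ and consider the semi-discrete local discontinuous Galerkin scheme for the coupled dispersionless system $\rho_s+(\frac12u^2)_y=0$, $u_{ys}=\rho u$ on $I=[y_L,y_R]$: find $u_h,\rho_h,\omega_h,\gamma_h$ (functions of time $s$ with values in $V_h^k$) such that for all test functions $\phi,\varphi,\psi,\eta\in V_h^k$ and all cells $I_j$, $1\le j\le N$, $$((\rho_h)_s,\phi)_{I_j}+\langle\widehat{\gamma_h},\phi\rangle_{I_j}-(\gamma_h,\phi_y)_{I_j}=0,$$ $$((\omega_h)_s,\varphi)_{I_j}=(\rho_hu_h,\varphi)_{I_j},$$ $$(\omega_h,\psi)_{I_j}=\langle\widehat{u_h},\psi\rangle_{I_j}-(u_h,\psi_y)_{I_j},$$ $$(\gamma_h,\eta)_{I_j}=(\tfrac12u_h^2,\eta)_{I_j},$$ with periodic or homogeneous Dirichlet boundary conditions. Let $H_0(\rho_h,u_h)=\int_I\rho_hu_h^2\,dy$. (i) If the numerical fluxes are $\widehat{\gamma_h}=\{\gamma_h\}$ and $\widehat{u_h}=\{u_h\}$, then any solution of the scheme preserves $H_0$: $\frac{d}{ds}H_0(\rho_h,u_h)=0$. (ii) If the numerical fluxes are $$\widehat{\gamma_h}=\{\gamma_h\}-\alpha[\rho_h]-\beta[\gamma_h],\qquad \widehat{u_h}=\{u_h\}+\mu[u_h]$$ with constants satisfying $\alpha=0$, $\beta\ge0$, $\mu\ge0$ and $\beta+\mu\ne0$, then the scheme is dissipative on $H_0$: $\frac{d}{ds}H_0(\rho_h,u_h)\le0$ for any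 solution of the scheme.
   Context: The interval $I=[y_L,y_R]$ is partitioned into cells $I_j=[y_{j-1/2},y_{j+1/2}]$, $j=1,\dots,N$, with $y_{1/2}=y_L$, $y_{N+1/2}=y_R$. $V_h^k$ is the space of functions $v$ on $I$ with $v|_{I_j}\in P^k(I_j)$ for all $j$ (polynomials of degree at most $k$ on each cell, possibly discontinuous across interfaces). $u^-_{j+1/2}$ and $u^+_{j+1/2}$ denote the values of $u$ at $y_{j+1/2}$ from the left cell $I_j$ and the right cell $I_{j+1}$; $[u]=u^+-u^-$ is the jump and $\{u\}=\frac12(u^++u^-)$ the average. For each cell, $(u,v)_{I_j}=\int_{I_j}uv\,dy$ and $\langle\hat u,v\rangle_{I_j}=\hat u_{j+1/2}v^-_{j+1/2}-\hat u_{j-1/2}v^+_{j-1/2}$. Subscript $s$ denotes the time derivative, and the semi-discrete solution is differentiable in time. With periodic boundary conditions, the exterior traces at $y_{1/2}$ and $y_{N+1/2}$ are defined by periodicity; with homogeneous Dirichlet boundary conditions the exterior traces (at $y_{1/2}^-$ and $y_{N+1/2}^+$) of $u_h$ and $\gamma_h$ are zero. *)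

(* Defs.v *)
From mathcomp Require Export all_boot all_order all_algebra.
From mathcomp Require Export all_classical all_reals all_analysis.

Set Implicit Arguments.
Unset Strict Implicit.
Unset Printing Implicit Defensive.

Import Order.TTheory GRing.Theory Num.Theory.
Import numFieldNormedType.Exports.

Local Open Scope classical_set_scope.
Local Open Scope ring_scope.

(** A mesh with [N = n.+1] cells is given by its [N + 1] nodes
    [x : 'I_n.+2 -> R].  The cell [j : 'I_n.+1] (numbered from 0) lies between
    the node of index [j], which is [lift ord_max j], and the node of index
    [j + 1], which is [lift ord0 j]. *)
Definition lnode n (j : 'I_n.+1) : 'I_n.+2 := lift ord_max j.
Definition rnode n (j : 'I_n.+1) : 'I_n.+2 := lift ord0 j.

Definition is_mesh (R : realType) n (yL yR : R) (x : 'I_n.+2 -> R) : Prop :=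
  [/\ x ord0 = yL, x ord_max = yR & forall j : 'I_n.+1, x (lnode j) < x (rnode j)].

(** The broken polynomial space: one polynomial of degree at most [k] (size at
    most [k.+1]) per cell.  An element has two values at each interior node. *)
Definition Vh (R : realType) (n k : nat) := 'I_n.+1 -> {poly_(k.+1) R}.

Inductive boundary := Periodic | Dirichlet.

Section Scheme.
Variables (R : realType) (n k : nat) (x : 'I_n.+2 -> R).
Implicit Types (v : Vh R n k) (i : 'I_n.+2) (j : 'I_n.+1) (s y : R).

Definition cell j : set R := `[x (lnode j), x (rnode j)].

Definition cell_int j (f : R -> R) : R := \int[lebesgue_measure]_(y in cell j) f y.

(** The element [v] as a function on the interval; an interior node is given the
    value from its right cell and the last node the value 0, which is irrelevant
    under an integral. *)
Definition piecewise v (y : R) : R :=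
  \sum_(j < n.+1 | (x (lnode j) <= y) && (y < x (rnode j))) (v j).[y].

(** [v^-] and [v^+] at the node [i].  [unlift ord0 i] is the cell on the left of
    [i], [unlift ord_max i] the one on its right, and [None] means that the trace
    is exterior; [e] is its prescribed value when [bc] is not periodic. *)
Definition trace_minus (bc : boundary) (e : R) v i : R :=
  if unlift ord0 i is Some j then (v j).[x i]
  else if bc is Periodic then (v ord_max).[x ord_max] else e.

Definition trace_plus (bc : boundary) (e : R) v i : R :=
  if unlift ord_max i is Some j then (v j).[x i]
  else if bc is Periodic then (v ord0).[x ord0] else e.

Definition jump bc (eL eR : R) v i : R :=
  trace_plus bc eR v i - trace_minus bc eL v i.

Definition average bc (eL eR : R) v i : R :=
  2^-1 * (trace_plus bc eR v i + trace_minus bc eL v i).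

(** The pairing of a numerical flux [hat] with a test function over a cell: both
    traces of the test function are taken from inside the cell. *)
Definition flux_pairing (hat : 'I_n.+2 -> R) v j : R :=
  hat (rnode j) * (v j).[x (rnode j)] - hat (lnode j) * (v j).[x (lnode j)].

Definition time_differentiable (T : set R) (v : R -> Vh R n k) : Prop :=
  forall s, T s -> forall j y, cell j y -> derivable (fun t => (v t j).[y]) s 1.

Definition dt (v : R -> Vh R n k) s j y : R := derive1 (fun t => (v t j).[y]) s.

(** Solutions over the set of times [T], for numerical fluxes [ghat] of gamma and
    [uhat] of u, given as functions of time and of the node. *)
Record ldg_solution (T : set R) (ghat uhat : R -> 'I_n.+2 -> R)
    (u rho omega gamma : R -> Vh R n k) : Prop := LdgSolution {
  ldg_diff_u : time_differentiable T u;
  ldg_diff_rho : time_differentiable T rho;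
  ldg_diff_omega : time_differentiable T omega;
  ldg_diff_gamma : time_differentiable T gamma;
  ldg_rho : forall s, T s -> forall (phi : Vh R n k) j,
    cell_int j (fun y => dt rho s j y * (phi j).[y])
    + flux_pairing (ghat s) phi j
    - cell_int j (fun y => (gamma s j).[y] * (deriv (phi j)).[y]) = 0;
  ldg_omega_t : forall s, T s -> forall (phi : Vh R n k) j,
    cell_int j (fun y => dt omega s j y * (phi j).[y])
    = cell_int j (fun y => (rho s j).[y] * (u s j).[y] * (phi j).[y]);
  ldg_omega : forall s, T s -> forall (psi : Vh R n k) j,
    cell_int j (fun y => (omega s j).[y] * (psi j).[y])
    = flux_pairing (uhat s) psi j
      - cell_int j (fun y => (u s j).[y] * (deriv (psi j)).[y]);
  ldg_gamma : forall s, T s -> forall (eta : Vh R n k) j,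
    cell_int j (fun y => (gamma s j).[y] * (eta j).[y])
    = cell_int j (fun y => 2^-1 * (u s j).[y] ^+ 2 * (eta j).[y])
}.

(** The exterior traces of u and gamma are 0 in the Dirichlet case. *)
Definition central_flux bc (v : R -> Vh R n k) s i : R := average bc 0 0 (v s) i.

(** Homogeneous Dirichlet conditions do not prescribe exterior traces of rho:
    they are the parameters [rhoL] and [rhoR], ignored in the periodic case. *)
Definition gamma_flux bc (rhoL rhoR : R -> R) (alpha beta : R)
    (rho gamma : R -> Vh R n k) s i : R :=
  average bc 0 0 (gamma s) i
  - alpha * jump bc (rhoL s) (rhoR s) (rho s) i
  - beta * jump bc 0 0 (gamma s) i.

Definition u_flux bc (mu : R) (u : R -> Vh R n k) s i : R :=
  average bc 0 0 (u s) i + mu * jump bc 0 0 (u s) i.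

Definition H0 (yL yR : R) (rho u : Vh R n k) : R :=
  \int[lebesgue_measure]_(y in `[yL, yR]) (piecewise rho y * piecewise u y ^+ 2).

End Scheme.

(* Main.v *)
Require Import Defs.
From HB Require Import structures.
From mathcomp Require Import ring lra.

Set Implicit Arguments.
Unset Strict Implicit.
Unset Printing Implicit Defensive.

Import Order.TTheory GRing.Theory Num.Theory.
Import numFieldNormedType.Exports.

Local Open Scope classical_set_scope.
Local Open Scope ring_scope.

(** On each cell, testing the equation of [gamma] with [rho_s], that of [rho] with
    [gamma], that of [omega_s] with [u_s] and the time derivative of that of
    [omega] with [u_s] gives
      d/ds int rho u^2 = - 2 (<ghat, gamma> - (gamma, gamma_y))
                         + 2 (<uhat_s, u_s> - (u_s, (u_s)_y)).
    As (v, v_y) is half the increment of v^2 over the cell, for a flux of the form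
    {v} + c [v] the sum over the cells of <vhat, v> - (v, v_y) telescopes to
    - c times the sum of the squared jumps.  Hence
      d/ds H0 = - 2 beta sum [gamma]^2 - 2 mu sum [u_s]^2. *)

(** * Integration of polynomials over a segment *)

Section PolyIntegral.
Context {R : realType}.
Implicit Types (a b : R) (p q : {poly R}).

Definition poly_int a b p : R := \int[lebesgue_measure]_(y in `[a, b]) p.[y].

Lemma integrable_horner a b p :
  lebesgue_measure.-integrable `[a, b] (EFin \o horner p).
Proof.
apply: continuous_compact_integrable; first exact: segment_compact.
exact/continuous_subspaceT/continuous_horner.
Qed.

Lemma poly_int_is_linear a b : linear_for *%R (poly_int a b).
Proof.
move=> c p q; rewrite /poly_int.
under eq_Rintegral do rewrite hornerD hornerZ.
rewrite RintegralD//; last exact: integrable_horner.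
  by rewrite RintegralZl//; exact: integrable_horner.
rewrite -[X in integrable _ _ X]/(EFin \o (fun y => c * p.[y])).
rewrite (_ : (fun y => _) = horner (c *: p)); first exact: integrable_horner.
by apply/funext => y; rewrite hornerZ.
Qed.

(** As a linear form, the integral over a cell falls under [coef_derive_linear]: it is
    differentiated in time without any limit under the integral sign. *)
HB.instance Definition _ a b := GRing.isLinear.Build R {poly R} R *%R
  (poly_int a b) (poly_int_is_linear a b).

Lemma poly_int_deriv a b p : a < b -> poly_int a b p^`() = p.[b] - p.[a].
Proof.
move=> ab; rewrite /poly_int /Rintegral (@continuous_FTC2 _ _ (horner p))//.
- exact/continuous_subspaceT/continuous_horner.
- split.
  + by move=> y _; exact: derivable_horner.
  + by apply: cvg_at_right_filter; exact: continuous_horner.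
  + by apply: cvg_at_left_filter; exact: continuous_horner.
- by move=> y _; rewrite derivE.
Qed.

End PolyIntegral.

(** * Time derivatives of polynomials depending on time *)

Section CoefDerive.
Context {R : realType}.
Implicit Types (P Q : R -> {poly R}) (D E : {poly R}) (s : R).

(* The degree bound makes every linear functional of [P t] a fixed finite sum of
   coefficients, so that it commutes with the time derivative. *)
Definition coef_derive P s D : Prop :=
  (exists N, forall t, (size (P t) <= N)%N) /\
  forall i, is_derive s 1 (fun t => (P t)`_i) D`_i.

Lemma is_derive_fsum n (h : 'I_n -> R -> R) (dh : 'I_n -> R) s :
  (forall i, is_derive s 1 (h i) (dh i)) ->
  is_derive s 1 (fun t => \sum_(i < n) h i t) (\sum_(i < n) dh i).
Proof.
move=> hdh; rewrite (_ : (fun _ => _) = \sum_(i < n) h i).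
  exact: is_derive_sum.
by apply/funext => t; rewrite fct_sumE.
Qed.

Lemma is_derive_fmul (f g : R -> R) s (df dg : R) :
  is_derive s 1 f df -> is_derive s 1 g dg ->
  is_derive s 1 (fun t => f t * g t) (df * g s + f s * dg).
Proof.
move=> fdf gdg; rewrite addrC (mulrC df); exact: is_deriveM.
Qed.

Lemma is_derive_fscale (f : R -> R) s (df c : R) :
  is_derive s 1 f df -> is_derive s 1 (fun t => f t * c) (df * c).
Proof.
move=> fdf; have -> : df * c = df * c + f s * 0 by rewrite mulr0 addr0.
apply: is_derive_fmul; exact: is_derive_cst.
Qed.

Lemma linear_coefE (L : {scalar {poly R}}) N (p : {poly R}) :
  (size p <= N)%N -> L p = \sum_(i < N) p`_i * L 'X^i.
Proof.
move=> pN; have {1}-> : p = \sum_(i < N) p`_i *: 'X^i.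
  rewrite -poly_def; apply/polyP => i; rewrite coef_poly.
  by case: ltnP => // Ni; rewrite nth_default// (leq_trans pN).
by rewrite linear_sum; apply: eq_bigr => i _; rewrite linearZ.
Qed.

Lemma coef_derive_size P s D N :
  coef_derive P s D -> (forall t, size (P t) <= N)%N -> (size D <= N)%N.
Proof.
move=> [_ PD] PN; apply/leq_sizeP => i Ni.
rewrite -(@derive_val _ _ _ _ _ _ _ (PD i)).
rewrite (_ : (fun _ => _) = cst 0) ?derive_cst//.
by apply/funext => t; rewrite nth_default// (leq_trans (PN t)).
Qed.

Lemma coef_derive_linear (L : {scalar {poly R}}) P s D :
  coef_derive P s D -> is_derive s 1 (fun t => L (P t)) (L D).
Proof.
move=> /[dup] PD [[N PN] PDi].
rewrite (linear_coefE L (coef_derive_size PD PN)).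
rewrite (_ : (fun _ => _) = fun t => \sum_(i < N) (P t)`_i * L 'X^i).
  by apply: is_derive_fsum => i; exact: is_derive_fscale.
by apply/funext => t; rewrite -linear_coefE.
Qed.

Lemma coef_deriveM P Q s D E :
  coef_derive P s D -> coef_derive Q s E ->
  coef_derive (fun t => P t * Q t) s (D * Q s + P s * E).
Proof.
move=> [[M PM] PD] [[N QN] QE]; split.
  exists (M + N)%N => t; apply: leq_trans (size_polyMleq _ _) _.
  by apply: leq_trans (leq_pred _) _; exact: leq_add.
move=> i; rewrite coefD !coefM -big_split/=.
under eq_fun do rewrite coefM.
by apply: is_derive_fsum => j; exact: is_derive_fmul.
Qed.

Lemma coef_derive_eval P s D y :
  coef_derive P s D -> is_derive s 1 (fun t => (P t).[y]) D.[y].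
Proof. exact: (@coef_derive_linear (horner_eval y)). Qed.

(* By Lagrange interpolation the coefficients are linear combinations of values
   at finitely many points of the interval. *)
Lemma coef_derive_ex N P s (a b : R) : a < b -> (0 < N)%N ->
  (forall t, size (P t) <= N)%N ->
  (forall y, y \in `[a, b] -> derivable (fun t => (P t).[y]) s 1) ->
  exists D, coef_derive P s D.
Proof.
move=> ab N0 PN Pdiff.
(* These points are pairwise distinct and stay in the segment for every [i], so one sequence serves
   all [N]. *)
pose c (i : nat) : R := a + (b - a) / i.+1%:R.
have c_inj : injective c.
  move=> i j /addrI/mulfI; rewrite subr_eq0 gt_eqF// => /(_ isT)/invr_inj/eqP.
  by rewrite eqr_nat => /eqP[].
have cab i : c i \in `[a, b].
  have ba0 : 0 <= b - a by rewrite subr_ge0 ltW.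
  rewrite in_itv/= lerDl divr_ge0//= -lerBrDl.
  by rewrite ler_piMr// invf_le1 ?ltr0Sn// ler1n.
pose l (i : 'I_N) : {poly R} := tnth (N.-lagrange c) i.
(* The derivative is the interpolant of the time derivatives of the values at the points [c i]. *)
exists (\sum_(i < N) 'D_1 (fun t => (P t).[c i]) s *: l i).
split; first by exists N.
move=> m.
rewrite (_ : (fun _ => _) = fun t => \sum_(i < N) (P t).[c i] * (l i)`_m).
  rewrite coef_sum; under eq_bigr do rewrite coefZ.
  apply: is_derive_fsum => i; apply: is_derive_fscale.
  exact/derivableP/Pdiff.
apply/funext => t; rewrite {1}(lagrange_gen N0 c_inj (PN t)) coef_sum.
by apply: eq_bigr => i _; rewrite mul_polyC coefZ.
Qed.

End CoefDerive.

(** * Telescoping of the fluxes over the mesh *)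

Section FluxEnergy.
Context {R : realType} {n k : nat}.
Variables (x : 'I_n.+2 -> R) (bc : boundary).
Implicit Types (v : Vh R n k) (c : R).

(* In the periodic case the first and last nodes are the same point, which must be
   counted once. *)
Definition jump_energy v : R :=
  \sum_(i < n.+2) jump x bc 0 0 v i ^+ 2
  - if bc is Periodic then jump x bc 0 0 v ord0 ^+ 2 else 0.

Lemma jump_energy_ge0 v : 0 <= jump_energy v.
Proof.
rewrite /jump_energy; case: (bc) => /=.
  rewrite big_ord_recl addrAC subrr add0r.
  by apply: sumr_ge0 => i _; exact: sqr_ge0.
by rewrite subr0; apply: sumr_ge0 => i _; exact: sqr_ge0.
Qed.

(** After regrouping by nodes, each node contributes [- c [v]^2]: as [{v} [v]] is half the jump of
    [v^2], the central part cancels. *)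
Lemma flux_energy v c :
  \sum_(j < n.+1) (flux_pairing x (fun i => average x bc 0 0 v i
                                   + c * jump x bc 0 0 v i) v j
    - 2^-1 * ((v j).[x (rnode j)] ^+ 2 - (v j).[x (lnode j)] ^+ 2))
  = - c * jump_energy v.
Proof.
set hat := fun i : 'I_n.+2 => _ + _.
(* [A i] and [B i] are the contributions of the node [i] to the cells on its left
   and on its right. *)
pose A i := hat i * trace_minus x bc 0 v i - 2^-1 * trace_minus x bc 0 v i ^+ 2.
pose B i := hat i * trace_plus x bc 0 v i - 2^-1 * trace_plus x bc 0 v i ^+ 2.
have AB i : A i - B i = - c * jump x bc 0 0 v i ^+ 2.
  by rewrite /A /B /hat /average /jump; field.
transitivity (\sum_(j < n.+1) A (rnode j) - \sum_(j < n.+1) B (lnode j)).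
  rewrite -sumrB; apply: eq_bigr => j _.
  rewrite /flux_pairing /A /B /trace_minus /trace_plus !liftK; ring.
have -> : \sum_(j < n.+1) A (rnode j) = \sum_i A i - A ord0.
  by rewrite [in RHS]big_ord_recl addrAC subrr add0r.
have -> : \sum_(j < n.+1) B (lnode j) = \sum_i B i - B ord_max.
  rewrite [in RHS]big_ord_recr/= addrK; apply: eq_bigr => j _; congr B.
  by apply: val_inj; rewrite /= /bump leqNgt ltn_ord.
transitivity (\sum_i (A i - B i) + (B ord_max - A ord0)).
  by rewrite [\sum_i (A i - B i)]sumrB; ring.
under eq_bigr do rewrite AB.
rewrite -mulr_sumr /jump_energy mulrBr; congr (_ + _).
(* The boundary terms remain. With Dirichlet conditions the exterior traces are 0 and both terms
   vanish; with periodic ones [B ord_max = B ord0], and the difference is [c] times the squared jump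
   that was counted twice. *)
have mx : @ord_max n.+1 = lift ord0 ord_max by exact: val_inj.
have l0 : @ord0 n.+1 = lift ord_max ord0 by exact: val_inj.
have tm0 : unlift ord0 (@ord0 n.+1) = None by rewrite unlift_none.
have tpm : unlift ord_max (@ord_max n.+1) = None by rewrite unlift_none.
have tmm : unlift ord0 (@ord_max n.+1) = Some ord_max by rewrite mx liftK.
have tp0 : unlift ord_max (@ord0 n.+1) = Some ord0 by rewrite l0 liftK.
have := AB ord0; rewrite /A /B /hat /average /jump /trace_minus /trace_plus.
rewrite tm0 tpm tmm tp0; case: (bc) => /= AB0; last by ring.
by field.
Qed.

End FluxEnergy.

(** * Splitting [H0] into cell integrals *)

Local Notation cellp v j := (polyn (v j)).

Lemma Rintegral_fsum d (T : measurableType d) (R : realType)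
    (mu : {measure set T -> \bar R}) (D : set T) n (f : 'I_n -> T -> R) :
  measurable D -> (forall i, mu.-integrable D (EFin \o f i)) ->
  \int[mu]_(y in D) (\sum_(i < n) f i y) = \sum_(i < n) \int[mu]_(y in D) f i y.
Proof.
move=> mD; elim: n f => [|n IH] f fi.
  rewrite big_ord0; under eq_Rintegral do rewrite big_ord0.
  by rewrite Rintegral_cst// mul0r.
rewrite big_ord_recr -IH//; under eq_Rintegral do rewrite big_ord_recr.
rewrite RintegralD//.
rewrite (_ : _ \o _ = fun y => (\sum_(i < n) (f (widen_ord (leqnSn n) i) y)%:E)%E).
  by apply: integrable_sum => // i _; exact: fi.
by apply/funext => y /=; rewrite sumEFin.
Qed.

Section Mesh.
Context {R : realType} {n : nat} {yL yR : R} {x : 'I_n.+2 -> R}.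
Hypothesis hx : is_mesh yL yR x.
Implicit Types (i j : 'I_n.+1) (y : R).

Lemma lnodeE j : lnode j = j :> nat.
Proof. by rewrite /= /bump leqNgt ltn_ord. Qed.

Lemma mesh_le (a b : 'I_n.+2) : (a <= b)%N -> x a <= x b.
Proof.
have [_ _ lr] := hx.
move=> /subnK; move: (b - a)%N => m; elim: m b => [|m IH] b abm.
  by rewrite (_ : a = b)//; exact: val_inj.
(* A node [b] other than the first is the right end of a cell, whose left end is the preceding
   node. *)
have [j bj|b0] := unliftP ord0 b; last by move: abm; rewrite b0.
have ab : (m + a)%N = lnode j.
  by rewrite lnodeE; move: abm; rewrite bj addSn => -[].
by rewrite (le_trans (IH _ ab))// bj ltW// lr.
Qed.

Definition in_cell j y := (x (lnode j) <= y) && (y < x (rnode j)).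

Lemma in_cell_inj i j y : in_cell i y -> in_cell j y -> i = j.
Proof.
suff lt_abs (a b : 'I_n.+1) : in_cell a y -> in_cell b y -> (a < b)%N -> False.
  move=> iy jy; apply: val_inj.
  by have [/(lt_abs _ _ iy jy)|/(lt_abs _ _ jy iy)|] := ltngtP i j.
move=> /andP[_ ya] /andP[yb _] ab.
have : x (rnode a) <= x (lnode b) by rewrite mesh_le// lnodeE.
by move=> /(lt_le_trans ya)/lt_le_trans/(_ yb); rewrite ltxx.
Qed.

Lemma H0E k (rho u : Vh R n k) :
  H0 x yL yR rho u =
  \sum_(j < n.+1) poly_int (x (lnode j)) (x (rnode j))
    (cellp rho j * (cellp u j * cellp u j)).
Proof.
have [xL xR _] := hx.
pose I j := [set` `[x (lnode j), x (rnode j)[].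
pose p j := cellp rho j * (cellp u j * cellp u j).
rewrite /H0.
transitivity (\int[lebesgue_measure]_(y in `[yL, yR])
   \sum_(j < n.+1) (horner (p j) \_ (I j)) y).
  apply: eq_Rintegral => y _; rewrite /piecewise /patch.
  have Iy j : (y \in I j) = in_cell j y.
    by rewrite /I mem_setE in_itv.
  under [RHS]eq_bigr do rewrite Iy.
  rewrite -big_mkcond/= -/(in_cell _ _).
  (* Either no cell contains [y], as for [y = yR], and both sides are 0, or exactly one does, and
     the product of the sums has no cross terms. *)
  have [j0 j0y|noy] := pickP (in_cell^~ y); last first.
    by rewrite !big_pred0// mul0r.
  have jE : (in_cell^~ y) =1 pred1 j0.
    by move=> j /=; apply/idP/eqP => [/in_cell_inj/(_ j0y)//|->].
  by rewrite !(big_pred1 j0 jE) /p !hornerM.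
have pI j : lebesgue_measure.-integrable (I j) (EFin \o horner (p j)).
  apply: integrableS (integrable_horner (x (lnode j)) (x (rnode j)) (p j)).
  - exact: measurable_itv.
  - exact: measurable_itv.
  - by apply: subset_itvl; rewrite bnd_simp.
rewrite Rintegral_fsum; first last.
- move=> j; apply: (@integrableS _ _ _ _ setT).
  + exact: measurableT.
  + exact: measurable_itv.
  + exact: subsetT.
  + rewrite -restrict_EFin -integrable_mkcond; first exact: pI.
    exact: measurable_itv.
- exact: measurable_itv.
(* Each cell lies in [[yL, yR]], and closing it at its right node adds a null set. *)
apply: eq_bigr => j _; rewrite -Rintegral_mkcondr setIidr.
  exact: Rintegral_itv_bndo_bndc (pI j).
rewrite -xL -xR; apply: subset_itv; rewrite bnd_simp mesh_le//.
exact: leq_ord.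
Qed.

End Mesh.

(** * The energy identity along solutions *)

Section Scheme.
Context {R : realType} {n k : nat} {yL yR : R} {x : 'I_n.+2 -> R}.
Hypothesis hx : is_mesh yL yR x.
Variable bc : boundary.
Implicit Types (v : R -> Vh R n k) (s c : R) (j : 'I_n.+1).

Lemma cell_intE j (f : R -> R) (p : {poly R}) : (forall y, f y = p.[y]) ->
  cell_int x j f = poly_int (x (lnode j)) (x (rnode j)) p.
Proof. by move=> fp; apply: eq_Rintegral => y _. Qed.

Lemma poly_int_mul_deriv (a b : R) (p : {poly R}) : a < b ->
  poly_int a b (p * p^`()) = 2^-1 * (p.[b] ^+ 2 - p.[a] ^+ 2).
Proof.
move=> ab; have := poly_int_deriv (p * p) ab.
rewrite derivM (mulrC p^`()) linearD/= !hornerM; lra.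
Qed.

(** The degree bound passes to the derivative, which makes [u_s] and [rho_s] admissible test
    functions. *)
Lemma Vh_derive T v s : time_differentiable x T v -> T s ->
  exists Dv : Vh R n k, forall j, coef_derive (fun t => v t j) s (Dv j).
Proof.
have [_ _ lr] := hx.
move=> vT Ts.
suff /choice[Dv DvP] : forall j, exists D : {poly_(k.+1) R},
  coef_derive (fun t => v t j) s D by exists Dv.
move=> j.
have vk t : (size (v t j : {poly R}) <= k.+1)%N by exact: size_npoly.
have [D DP] := coef_derive_ex (P := fun t => v t j) (lr j) (ltn0Sn k) vk
  (fun y => vT s Ts j y).
by exists (NPoly (coef_derive_size DP vk)).
Qed.

Lemma dtE v s (Dv : Vh R n k) j y :
  (forall j, coef_derive (fun t => v t j) s (Dv j)) ->
  dt v s j y = (Dv j).[y].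
Proof.
by move=> /(_ j)/(coef_derive_eval y) vD; rewrite /dt derive1E derive_val.
Qed.

(** A trace is the value of a cell polynomial at a fixed point, or the Dirichlet value 0, which is
    constant in time. *)
Lemma is_derive_trace v s (Dv : Vh R n k) (i : 'I_n.+2) :
  (forall j, coef_derive (fun t => v t j) s (Dv j)) ->
  is_derive s 1 (fun t => trace_minus x bc 0 (v t) i)
    (trace_minus x bc 0 Dv i) /\
  is_derive s 1 (fun t => trace_plus x bc 0 (v t) i)
    (trace_plus x bc 0 Dv i).
Proof.
move=> vD; rewrite /trace_minus /trace_plus.
have vDy j y := coef_derive_eval y (vD j).
split; case: unlift => [j|]; do ?exact: vDy; case: (bc);
  do ?exact: vDy; exact: is_derive_cst.
Qed.

(** Common form of the fluxes: [c] is 0 for the central ones, [mu] for u and, when [alpha = 0],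
    [- beta] for gamma. *)
Definition penalized_flux c v s i : R :=
  average x bc 0 0 (v s) i + c * jump x bc 0 0 (v s) i.

(** A flux is linear in the two traces, with weights [1/2 + c] and [1/2 - c] constant in time, so it
    commutes with the time derivative. *)
Lemma is_derive_flux_pairing c v s (Dv phi : Vh R n k) j :
  (forall j, coef_derive (fun t => v t j) s (Dv j)) ->
  is_derive s 1 (fun t => flux_pairing x (penalized_flux c v t) phi j)
    (flux_pairing x (penalized_flux c (fun=> Dv) s) phi j).
Proof.
move=> vD.
have hD i : is_derive s 1 (fun t => penalized_flux c v t i)
    (penalized_flux c (fun=> Dv) s i).
  have [mD pD] := is_derive_trace i vD.
  pose tm t := trace_minus x bc 0 (v t) i.
  pose tp t := trace_plus x bc 0 (v t) i.
  rewrite (_ : (fun _ => _) = fun t => tp t * (2^-1 + c) + tm t * (2^-1 - c)).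
    rewrite (_ : penalized_flux _ _ _ _ = trace_plus x bc 0 Dv i * (2^-1 + c)
      + trace_minus x bc 0 Dv i * (2^-1 - c)).
      by apply: is_deriveD; exact: is_derive_fscale.
    by rewrite /penalized_flux /average /jump; ring.
  by apply/funext => t; rewrite /penalized_flux /average /jump /tm /tp; ring.
by apply: is_deriveB; exact: is_derive_fscale.
Qed.

(** The identity announced at the start, with [b] for [- beta] and [m] for [mu], both of any sign;
    the witness [Du] is [u_s]. *)
Lemma H0_is_derive (T : set R) (u rho omega gamma : R -> Vh R n k) b m s :
  open T ->
  ldg_solution x T (penalized_flux b gamma) (penalized_flux m u)
    u rho omega gamma -> T s ->
  exists Du : Vh R n k, is_derive s 1 (fun t => H0 x yL yR (rho t) (u t))
    (2 * (b * jump_energy x bc (gamma s) - m * jump_energy x bc Du)).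
Proof.
have [_ _ lr] := hx.
move=> oT [du drho domega _ e_rho e_omegat e_omega e_gamma] Ts.
have [Du uD] := Vh_derive du Ts.
have [Drho rhoD] := Vh_derive drho Ts.
have [Domega omegaD] := Vh_derive domega Ts.
pose J j : {scalar {poly R}} := poly_int (x (lnode j)) (x (rnode j)).
have e1 j : J j (cellp (gamma s) j * cellp Drho j)
    + flux_pairing x (penalized_flux b gamma s) (gamma s) j
    - J j (cellp (gamma s) j * (cellp (gamma s) j)^`()) = 0.
  rewrite -(e_rho s Ts (gamma s) j); congr (_ + _ - _).
    by apply/esym/cell_intE => y; rewrite (dtE _ _ rhoD) hornerM mulrC.
  by apply/esym/cell_intE => y; rewrite hornerM.
have e2 j : J j (cellp (gamma s) j * cellp Drho j) =
    2^-1 * J j (cellp (u s) j * cellp (u s) j * cellp Drho j).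
  rewrite -linearZ/=.
  transitivity (cell_int x j (fun y => (gamma s j).[y] * (Drho j).[y])).
    by apply/esym/cell_intE => y; rewrite hornerM.
  rewrite (e_gamma s Ts Drho j); apply/cell_intE => y.
  by rewrite hornerZ !hornerM; ring.
have e3 j : J j (cellp Domega j * cellp Du j) =
    J j (cellp (rho s) j * cellp (u s) j * cellp Du j).
  transitivity (cell_int x j (fun y => dt omega s j y * (Du j).[y])).
    by apply/esym/cell_intE => y; rewrite (dtE _ _ omegaD) hornerM.
  by rewrite (e_omegat s Ts Du j); apply/cell_intE => y; rewrite !hornerM.
have e4 j : J j (cellp Domega j * cellp Du j) =
    flux_pairing x (penalized_flux m (fun=> Du) s) Du j
    - J j (cellp Du j * (cellp Du j)^`()).
  have JD v (Dv : Vh R n k) (q : {poly R}) :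
      (forall j, coef_derive (fun t => cellp (v t) j) s (cellp Dv j)) ->
      is_derive s 1 (fun t => J j (cellp (v t) j * q)) (J j (cellp Dv j * q)).
    move=> vD.
    (* [q] is constant in time, with derivative 0, so the product rule applies. *)
    rewrite -[cellp Dv j * q]addr0 -[X in _ + X](mulr0 (cellp (v s) j)).
    apply: coef_derive_linear; apply: coef_deriveM => //.
    by split=> [|i]; [exists (size q)|rewrite coef0; exact: is_derive_cst].
  rewrite -(@derive_val _ _ _ _ _ _ _ (JD _ _ (cellp Du j) omegaD)).
  rewrite -(@derive_val _ _ _ _ _ _ _ (is_deriveB
    (is_derive_flux_pairing m Du j uD) (JD _ _ (cellp Du j)^`() uD))).
  (* As [T] is open, the equation of omega holds at all times near [s], so its two sides have the
     same derivative there. *)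
  apply: near_eq_derive; near=> t.
  have Tt : T t by near: t; exact: open_nbhs_nbhs.
  transitivity (cell_int x j (fun y => (omega t j).[y] * (Du j).[y])).
    by apply/esym/cell_intE => y; rewrite hornerM.
  rewrite (e_omega t Tt Du j); congr (_ - _).
  by apply/cell_intE => y; rewrite hornerM.
exists Du.
rewrite (_ : (fun _ => _) =
    fun t => \sum_(j < n.+1)
      J j (cellp (rho t) j * (cellp (u t) j * cellp (u t) j))); last first.
  by apply/funext => t; rewrite (H0E hx).
(* Undoing the telescoping turns both energies into sums over cells and leaves an identity on each
   cell. *)
rewrite -[b * _]opprK -mulNr -[- (m * _)]mulNr -!flux_energy.
rewrite -sumrN -big_split mulr_sumr/=; apply: is_derive_fsum => j.
have -> : 2 * (- (flux_pairing x (penalized_flux b gamma s) (gamma s) j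
    - 2^-1 * ((gamma s j).[x (rnode j)] ^+ 2 - (gamma s j).[x (lnode j)] ^+ 2))
  + (flux_pairing x (penalized_flux m (fun=> Du) s) Du j
    - 2^-1 * ((Du j).[x (rnode j)] ^+ 2 - (Du j).[x (lnode j)] ^+ 2)))
  = J j (cellp Drho j * (cellp (u s) j * cellp (u s) j)
    + cellp (rho s) j * (cellp Du j * cellp (u s) j + cellp (u s) j * cellp Du j)).
  (* By [e1] and [e2] the term in [rho_s] equals [-2] times the gamma bracket; by [e3] and [e4] each
     of the two terms in [u_s] equals the bracket of [u_s]. *)
  rewrite -!poly_int_mul_deriv//.
  have -> : cellp Drho j * (cellp (u s) j * cellp (u s) j)
      + cellp (rho s) j * (cellp Du j * cellp (u s) j + cellp (u s) j * cellp Du j)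
    = cellp (u s) j * cellp (u s) j * cellp Drho j
      + (cellp (rho s) j * cellp (u s) j * cellp Du j
        + cellp (rho s) j * cellp (u s) j * cellp Du j) by ring.
  rewrite 2!(linearD (J j)) -e3 e4.
  move: (e1 j) (e2 j); rewrite /J /=; lra.
by apply: coef_derive_linear; apply: coef_deriveM => //; exact: coef_deriveM.
Unshelve. all: by end_near. Qed.

End Scheme.

Theorem proposition2p2 (R : realType) (n k : nat) (yL yR : R)
    (x : 'I_n.+2 -> R) (hx : is_mesh yL yR x) (bc : boundary)
    (T : set R) (hT : open T) (u rho omega gamma : R -> Vh R n k) :
  (ldg_solution x T (central_flux x bc gamma) (central_flux x bc u)
      u rho omega gamma ->
    forall s : R, T s ->
      derivable (fun t : R => H0 x yL yR (rho t) (u t)) s 1 /\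
      derive1 (fun t : R => H0 x yL yR (rho t) (u t)) s = 0)
  /\
  (forall (alpha beta mu : R) (rhoL rhoR : R -> R),
    alpha = 0 -> 0 <= beta -> 0 <= mu -> beta + mu <> 0 ->
    ldg_solution x T (gamma_flux x bc rhoL rhoR alpha beta rho gamma)
      (u_flux x bc mu u) u rho omega gamma ->
    forall s : R, T s ->
      derivable (fun t : R => H0 x yL yR (rho t) (u t)) s 1 /\
      derive1 (fun t : R => H0 x yL yR (rho t) (u t)) s <= 0).
Proof.
split=> [|alpha beta mu rhoL rhoR -> beta0 mu0 _] sol s Ts.
- have centralE v : central_flux x bc v = penalized_flux (x := x) bc 0 v.
    apply/funext => t; apply/funext => i.
    by rewrite /penalized_flux mul0r addr0.
  rewrite !centralE in sol.
  have [Du HD] := H0_is_derive hx hT sol Ts.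
  by split; [exact: ex_derive|rewrite derive1E derive_val !mul0r subrr mulr0].
- have gammaE : gamma_flux x bc rhoL rhoR 0 beta rho gamma =
      penalized_flux (x := x) bc (- beta) gamma.
    apply/funext => t; apply/funext => i.
    by rewrite /gamma_flux /penalized_flux mul0r subr0 mulNr.
  rewrite gammaE in sol.
  have [Du HD] := H0_is_derive hx hT sol Ts.
  split; first exact: ex_derive.
  rewrite derive1E derive_val mulNr -opprD mulrN oppr_le0.
  by rewrite mulr_ge0// addr_ge0// mulr_ge0// jump_energy_ge0.
Qed.
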